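(* The entropy-based predictor-corrector algorithm (defined in the context) gives an $\epsilon$-solution in $O\left(\sqrt{n}\,\ln(1/\epsilon)\right)$ iterations.
   Context: Linear program (P): minimize $c^\top x$ subject to $Ax=b$, $x\ge 0$; dual (D): maximize $b^\top y$ subject to $A^\top y+s=c$, $s\ge 0$, where $A\in\mathbb R^{m\times n}$ has rank $m$, $b\in\mathbb R^m$, $c\in\mathbb R^n$. Let $\mathcal F_+:=\{(x,s): Ax=b,\ A^\top y+s=c \text{ for some } y\in\mathbb R^m,\ x>0,\ s>0\}$ (componentwise). For $(x,s)\in\mathcal F_+$ put $\mu:=x^\top s/n$. $X,S,V$ denote the diagonal matrices with diagonals $x,s,v$; $e$ is the all-ones vector; $\ln$ is applied to vectors componentwise. For $\beta\ge 0$, $\mathcal N_2(\beta):=\{(x,s)\in\mathcal F_+: \|Xs/\mu-e\|_2\le\beta\}$. For $(x,s)\in\mathcal F_+$ define $v:=X^{1/2}S^{1/2}e$, $D:=X^{1/2}S^{-1/2}$, $u:=Xs/\mu$, $\delta:=\frac1n\sum_{j=1}^n u_j\ln u_j$, and $w:=-v+\delta v-V\ln(Vv/\mu)$. For a right-hand side $r\in\mathbb R^n$, the scaled directions $\bar d_x,\bar d_s$ are given by the unique solution $(\bar d_x,\bar d_y,\bar d_s)$ of $(AD)^\top\bar d_y+\bar d_s=0$, $AD\,\bar d_x=0$, $\bar d_x+\bar d_s=r$ (that is, $\bar d_x$ is the orthogonal projection of $r$ onto the null space of $AD$, and $\bar d_s=r-\bar d_x$). Algorithm. Input: $A$, $b$,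 $c$, a starting point $(x^{(0)},s^{(0)})\in\mathcal N_2(\tfrac14)$, and the desired tolerance $\epsilon>0$. Set $(x,s)\leftarrow(x^{(0)},s^{(0)})$. While $x^\top s>\epsilon$ do: (Predictor step) compute $\bar d_x,\bar d_s$ for the right-hand side $r=w$; let $x(\alpha):=x+\alpha D\bar d_x$, $s(\alpha):=s+\alpha D^{-1}\bar d_s$, and $\alpha^*:=\max\{\alpha:(x(\alpha),s(\alpha))\in\mathcal N_2(\tfrac12)\}$; set $x\leftarrow x(\alpha^* )$, $s\leftarrow s(\alpha^* )$. (Corrector step) at the new $(x,s)$ compute $\bar d_x,\bar d_s$ for the right-hand side $r=-v+\mu V^{-1}e$; set $x\leftarrow x+D\bar d_x$, $s\leftarrow s+D^{-1}\bar d_s$. An iteration is one pass through the while loop; an $\epsilon$-solution is a point meeting the stopping criterion $x^\top s\le\epsilon$.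
   Formalization: The maximum defining α* need not exist (e.g. n = 1, where every α < 1 is admissible); in that case the predictor step is taken with the supremum and the corrector step is omitted. *)

(* Defs.v *)
From HB Require Import structures.
From mathcomp Require Import all_boot all_order all_algebra.
From mathcomp Require Import all_classical all_reals all_analysis.

Set Implicit Arguments.
Unset Strict Implicit.
Unset Printing Implicit Defensive.

Import Order.TTheory GRing.Theory Num.Theory.

Local Open Scope classical_set_scope.
Local Open Scope ring_scope.

Section EntropyPredictorCorrector.
Variables (R : realType) (m n : nat).

(* A pair (x, s) of primal variables and dual slacks. *)
Definition iterate : Type := ('cV[R]_n * 'cV[R]_n)%type.

Definition Diag (v : 'cV[R]_n) : 'M[R]_n := diag_mx v^T.

Definition allones : 'cV[R]_n := const_mx 1.

(* Explicit because the library norm on matrices is the sup norm. *)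
Definition norm2 (v : 'cV[R]_n) : R := Num.sqrt (\sum_(i < n) v i 0 ^+ 2).

Definition positive (v : 'cV[R]_n) : Prop := forall i, 0 < v i 0.

Definition gap (z : iterate) : R := (z.1^T *m z.2) 0 0.

Definition mu (z : iterate) : R := gap z / n%:R.

Definition strictly_feasible (A : 'M[R]_(m, n)) (b : 'cV[R]_m) (c : 'cV[R]_n) :
    set iterate :=
  [set z | [/\ A *m z.1 = b,
               exists y : 'cV[R]_m, A^T *m y + z.2 = c,
               positive z.1
             & positive z.2]].

Definition uvec (z : iterate) : 'cV[R]_n := (mu z)^-1 *: (Diag z.1 *m z.2).

Definition N2 (A : 'M[R]_(m, n)) (b : 'cV[R]_m) (c : 'cV[R]_n) (beta : R) :
    set iterate :=
  [set z | strictly_feasible A b c z /\ norm2 (uvec z - allones) <= beta].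

Definition sqrtDiag (v : 'cV[R]_n) : 'M[R]_n := Diag (map_mx Num.sqrt v).

Definition vvec (z : iterate) : 'cV[R]_n :=
  sqrtDiag z.1 *m sqrtDiag z.2 *m allones.

Definition Dmat (z : iterate) : 'M[R]_n := sqrtDiag z.1 *m invmx (sqrtDiag z.2).

Definition delta (z : iterate) : R :=
  n%:R^-1 * \sum_(j < n) uvec z j 0 * ln (uvec z j 0).

Definition wvec (z : iterate) : 'cV[R]_n :=
  let v := vvec z in
  - v + delta z *: v - Diag v *m map_mx (@ln R) ((mu z)^-1 *: (Diag v *m v)).

Definition corrector_rhs (z : iterate) : 'cV[R]_n :=
  - vvec z + mu z *: (invmx (Diag (vvec z)) *m allones).

Definition scaled_directions (A : 'M[R]_(m, n)) (z : iterate)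
    (r dx ds : 'cV[R]_n) : Prop :=
  exists dy : 'cV[R]_m,
    [/\ (A *m Dmat z)^T *m dy + ds = 0,
        A *m Dmat z *m dx = 0
      & dx + ds = r].

Definition move (z : iterate) (dx ds : 'cV[R]_n) (alpha : R) : iterate :=
  (z.1 + alpha *: (Dmat z *m dx), z.2 + alpha *: (invmx (Dmat z) *m ds)).

Definition is_maximum (S : set R) (a : R) : Prop := S a /\ ubound S a.

Definition admissible_steps (A : 'M[R]_(m, n)) (b : 'cV[R]_m) (c : 'cV[R]_n)
    (z : iterate) (dx ds : 'cV[R]_n) : set R :=
  [set alpha | N2 A b c 2^-1 (move z dx ds alpha)].

(* The maximum defining the predictor step length is not always attained: the
   gap of [move z dx ds alpha] is (1 - alpha) * gap z, and when every
   alpha in [0, 1[ is admissible (for instance when n = 1) the supremum 1 is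
   not admissible, since the gap vanishes there.  The move is then made with
   the supremum, and the corrector, which needs v > 0, is omitted. *)
Variant iteration (A : 'M[R]_(m, n)) (b : 'cV[R]_m) (c : 'cV[R]_n)
    (z : iterate) : iterate -> Prop :=
| PredictorCorrector (dx ds dx' ds' : 'cV[R]_n) (alpha : R) of
    scaled_directions A z (wvec z) dx ds &
    is_maximum (admissible_steps A b c z dx ds) alpha &
    (let z' := move z dx ds alpha in
     scaled_directions A z' (corrector_rhs z') dx' ds') :
    iteration A b c z (move (move z dx ds alpha) dx' ds' 1)
| PredictorLimit (dx ds : 'cV[R]_n) of
    scaled_directions A z (wvec z) dx ds &
    ~ (exists alpha, is_maximum (admissible_steps A b c z dx ds) alpha) :
    iteration A b c z
      (move z dx ds (sup (admissible_steps A b c z dx ds))).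

(* The while loop started at z never gets stuck and reaches its stopping
   criterion after at most k iterations, whatever admissible directions and
   step lengths are used (they are in fact unique). *)
Fixpoint halts_within (A : 'M[R]_(m, n)) (b : 'cV[R]_m) (c : 'cV[R]_n)
    (eps : R) (k : nat) (z : iterate) : Prop :=
  gap z <= eps \/
  match k with
  | 0%N => False
  | k'.+1 => (exists z', iteration A b c z z') /\
             (forall z', iteration A b c z z' -> halts_within A b c eps k' z')
  end.

End EntropyPredictorCorrector.

(* Main.v *)
Require Import Defs.
From HB Require Import structures.
From mathcomp Require Import all_boot all_order all_algebra.
From mathcomp Require Import all_classical all_reals all_analysis.
From mathcomp Require Import ring lra.

(* A predictor step along w multiplies the gap by 1 - t.  Writing u = Xs/mu, the
   centrality residual after a step t is
     (1 - t) (x s - mu) + t mu u (delta - ln u) + t^2 dx ds,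
   and in N_2(1/4) the second term has norm at most (5/12) t mu because u is
   within 1/4 of 1, while |w|^2 <= 2 n mu bounds the third by t^2 n mu.  Hence
   t = 1/(4 sqrt n) stays in N_2(1/2).  The corrector then turns the products
   x s into mu + dx ds with |dx ds| <= |r|^2/2 <= mu/4, which restores N_2(1/4)
   without changing the gap.  So every iteration multiplies the gap by at most
   1 - 1/(4 sqrt n), except when no maximal step exists: then the supremum of
   the admissible steps is 1 and the gap drops to 0. *)

Import Order.TTheory GRing.Theory Num.Theory.
Import numFieldNormedType.Exports.
Local Open Scope ring_scope.

(** * Inequalities for finite sums and the logarithm, and passage to a supremum *)

Section RealSums.
Context {R : realType}.

(** Minkowski's inequality for the Euclidean norm, stated on squares to avoid roots. Termwise it is
    a weighted convexity bound with slack [(b * f i - a * g i) ^+ 2]. *)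
Lemma sumsq_add_le {I : finType} (f g : I -> R) (a b : R) :
  0 < a -> 0 < b -> \sum_i f i ^+ 2 <= a ^+ 2 -> \sum_i g i ^+ 2 <= b ^+ 2 ->
  \sum_i (f i + g i) ^+ 2 <= (a + b) ^+ 2.
Proof.
move=> a0 b0 fa gb.
have ab0 : 0 < a * b by apply: mulr_gt0.
rewrite -(ler_pM2l ab0) mulr_sumr.
apply: (@le_trans _ _ (\sum_i ((a + b) * (b * f i ^+ 2 + a * g i ^+ 2)))).
  apply: ler_sum => i _; rewrite -subr_ge0.
  have -> : (a + b) * (b * f i ^+ 2 + a * g i ^+ 2) - a * b * (f i + g i) ^+ 2
    = (b * f i - a * g i) ^+ 2 by ring.
  exact: sqr_ge0.
rewrite -mulr_sumr big_split /= -!mulr_sumr.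
have -> : a * b * (a + b) ^+ 2 = (a + b) * (b * a ^+ 2 + a * b ^+ 2) by ring.
by rewrite ler_pM2l ?addr_gt0// lerD// ler_pM2l.
Qed.

Lemma sum_term_le {I : finType} (f : I -> R) i :
  (forall j, 0 <= f j) -> f i <= \sum_j f j.
Proof.
by move=> f0; rewrite (bigD1 i) //= lerDl; apply: sumr_ge0 => j _; apply: f0.
Qed.

(** Orthogonality makes the sum on the right [P + Q]. Bounding each [q i ^+ 2] by [Q] gives [P * Q]
    on the left, and AM-GM concludes. *)
Lemma sumsq_prod_le {I : finType} (p q : I -> R) :
  \sum_i p i * q i = 0 ->
  \sum_i (p i * q i) ^+ 2 <= (2^-1 * \sum_i (p i + q i) ^+ 2) ^+ 2.
Proof.
move=> pq0.
set P := \sum_i p i ^+ 2; set Q := \sum_i q i ^+ 2.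
have -> : \sum_i (p i + q i) ^+ 2 = P + Q.
  transitivity (P + Q + 2 * \sum_i p i * q i); last by rewrite pq0 mulr0 addr0.
  by rewrite mulr_sumr -!big_split /=; apply: eq_bigr => i _; ring.
have Q0 : 0 <= Q by apply: sumr_ge0 => i _; apply: sqr_ge0.
apply: (@le_trans _ _ (P * Q)).
  rewrite /P mulr_suml; apply: ler_sum => i _; rewrite exprMn.
  apply: ler_wpM2l; first exact: sqr_ge0.
  by apply: (sum_term_le (fun i => q i ^+ 2)) => j; apply: sqr_ge0.
by have := sqr_ge0 (P - Q); nra.
Qed.

(* A linear function that changed sign would vanish on the way. *)
Lemma linear_pos (p p' q q' a : R) : 0 < p -> 0 <= a ->
  (forall t, 0 <= t <= a -> 0 < (p + t * p') * (q + t * q')) ->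
  0 < p + a * p'.
Proof.
move=> p0 a0 H; rewrite ltNge; apply/negP => le0.
have p'0 : p' < 0 by nra.
have t0 : 0 <= - p / p' <= a.
  have i0 : p'^-1 < 0 by rewrite invr_lt0.
  have ii : p' * p'^-1 = 1 by rewrite divff// lt_eqF.
  by apply/andP; split; nra.
by have := H _ t0; rewrite divfK ?lt_eqF// subrr mul0r ltxx.
Qed.

(** From [1 - u^-1 <= ln u <= u - 1]: the upper bound serves [u >= 1]; below 1 the lower bound is
    [(u - 1) / u], where [u^-1 <= 4 / 3]. *)
Lemma ln_sqr_le (u : R) : 3 / 4 <= u -> ln u ^+ 2 <= 16 / 9 * (u - 1) ^+ 2.
Proof.
move=> u34; have u0 : 0 < u by lra.
have h1 : ln u <= u - 1.
  by have := @le_ln1Dx R (u - 1); rewrite subrKC; apply; lra.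
have h2 : 1 - u^-1 <= ln u.
  rewrite -[ln u]opprK -lnV ?posrE//.
  have ui : 0 < u^-1 by rewrite invr_gt0.
  have := @le_ln1Dx R (u^-1 - 1); rewrite subrKC => /(_ _).
  by lra.
have ui : u * u^-1 = 1 by rewrite divff// gt_eqF.
have [u1|u1] := leP 1 u.
  have ui1 : u^-1 <= 1 by rewrite invf_le1.
  have : 0 <= ln u by lra.
  nra.
have h3 : 4 / 3 * (u - 1) <= ln u by nra.
have : ln u <= 0 by lra.
nra.
Qed.

(** The supremum lies in the closure of [S], and the set where a polynomial is nonnegative is
    closed. *)
Lemma sup_horner_ge0 (S : set R) (p : {poly R}) :
  (S !=set0)%classic -> has_ubound S ->
  (forall a, S a -> 0 <= p.[a]) -> 0 <= p.[sup S].
Proof.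
move=> S0 Sub Sp.
have cl : closed ((horner p) @^-1` [set x | 0 <= x])%classic.
  apply: preimage_closed; last exact: closed_ge.
  by move=> x _; apply: continuous_horner.
apply: (cl (sup S)); apply: (closure_subset _ (closure_sup S0 Sub)).
by move=> a /Sp.
Qed.
End RealSums.

(** * Diagonal matrices and orthogonal projection *)

Section Steps.
Context {R : realType} {n : nat}.
Implicit Types v w : 'cV[R]_n.

Let entryD i v w : (v + w) i 0 = v i 0 + w i 0. Proof. by rewrite mxE. Qed.
Let entryN i v : (- v) i 0 = - v i 0. Proof. by rewrite mxE. Qed.
Let entryZ i (a : R) v : (a *: v) i 0 = a * v i 0. Proof. by rewrite mxE. Qed.
Let entry_map i (f : R -> R) v : map_mx f v i 0 = f (v i 0).
Proof. by rewrite mxE. Qed.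
Definition col_entryE := (entryD, entryN, entryZ, entry_map).

Lemma Diag_mulE v w i : (Diag v *m w) i 0 = v i 0 * w i 0.
Proof. by rewrite /Diag mul_diag_mx !mxE. Qed.

Lemma Diag_mulV v w : (forall i, v i 0 * w i 0 = 1) -> Diag v *m Diag w = 1%:M.
Proof.
move=> vw; rewrite /Diag mulmx_diag; apply/matrixP => i j; rewrite !mxE.
by rewrite vw.
Qed.

Lemma invmx_Diag v w :
  (forall i, v i 0 * w i 0 = 1) -> invmx (Diag v) = Diag w.
Proof.
move=> /Diag_mulV vw; have [uv _] := mulmx1_unit vw.
by rewrite -[invmx _]mulmx1 -vw mulKmx.
Qed.

(** The diagonal entries of [M *m M^T] are the squared norms of the rows of [M]. *)
Lemma mulmx_tr_eq0 (k : nat) (M : 'M[R]_(k, n)) : M *m M^T = 0 -> M = 0.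
Proof.
move=> MM; apply/matrixP => i j; rewrite [RHS]mxE; apply/eqP.
rewrite -sqrf_eq0 eq_le sqr_ge0 andbT.
have := congr1 (fun X : 'M[R]_k => X i i) MM; rewrite !mxE => <-.
under eq_bigr => l _ do rewrite mxE -expr2.
by apply: (sum_term_le (fun l => M i l ^+ 2)) => l; apply: sqr_ge0.
Qed.

(** If [K] annihilates the Gram matrix, then [(K M) (K M)^T = 0], so [K M = 0], and row freeness
    gives [K = 0]. *)
Lemma gram_unitmx (k : nat) (M : 'M[R]_(k, n)) :
  row_free M -> M *m M^T \in unitmx.
Proof.
move=> fM; rewrite -row_free_unit -kermx_eq0.
set K := kermx _; have KM : K *m (M *m M^T) = 0 by apply: mulmx_ker.
rewrite -(mulmx_free_eq0 K fM); apply/eqP/mulmx_tr_eq0.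
by rewrite trmx_mul mulmxA -(mulmxA K) KM mul0mx.
Qed.

Lemma projection_ex (k : nat) (M : 'M[R]_(k, n)) r : row_free M ->
  exists dx ds : 'cV[R]_n, exists dy : 'cV[R]_k,
    [/\ M^T *m dy + ds = 0, M *m dx = 0 & dx + ds = r].
Proof.
(* The solution of the normal equations; [ds] is then the projection of [r] onto the row space of
   [M]. *)
move=> fM; pose dy := - (invmx (M *m M^T) *m (M *m r)).
pose ds := - (M^T *m dy).
exists (r - ds), ds, dy; split; rewrite ?subrK ?addrN//.
rewrite mulmxBr /ds /dy !mulmxN opprK !mulmxA mulmxV ?gram_unitmx//.
by rewrite mul1mx subrr.
Qed.

(** * Coordinate formulas for iterates, and moves along scaled directions *)

Context {m : nat} (A : 'M[R]_(m, n)) (b : 'cV[R]_m) (c : 'cV[R]_n).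
Implicit Types (z : iterate R n) (dx ds r : 'cV[R]_n).

Definition positive_pair z := positive z.1 /\ positive z.2.

Lemma gapE z : gap z = \sum_i z.1 i 0 * z.2 i 0.
Proof. by rewrite /gap mxE; apply: eq_bigr => i _; rewrite mxE. Qed.

Lemma gap_gt0 z : (0 < n)%N -> positive_pair z -> 0 < gap z.
Proof.
move=> n0 [x0 s0]; rewrite gapE (bigD1 (Ordinal n0))//= ltr_pwDl ?mulr_gt0//.
by apply: sumr_ge0 => i _; rewrite ltW ?mulr_gt0.
Qed.

Lemma mu_gt0 z : (0 < n)%N -> positive_pair z -> 0 < mu z.
Proof. by move=> n0 iz; rewrite divr_gt0 ?gap_gt0 ?ltr0n. Qed.

Lemma gap_mu z : (0 < n)%N -> gap z = n%:R * mu z.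
Proof. by move=> n0; rewrite /mu mulrC divfK// pnatr_eq0 -lt0n. Qed.

Lemma uvecE z i : uvec z i 0 = (mu z)^-1 * (z.1 i 0 * z.2 i 0).
Proof. by rewrite /uvec col_entryE Diag_mulE. Qed.

Lemma vvecE z i : vvec z i 0 = Num.sqrt (z.1 i 0) * Num.sqrt (z.2 i 0).
Proof. by rewrite /vvec -mulmxA !Diag_mulE !mxE mulr1. Qed.

Lemma vvec_sqr z i : positive_pair z -> vvec z i 0 * vvec z i 0 = z.1 i 0 * z.2 i 0.
Proof.
by move=> [x0 s0]; rewrite vvecE mulrACA -!expr2 !sqr_sqrtr// ltW.
Qed.

Lemma vvec_gt0 z i : positive_pair z -> 0 < vvec z i 0.
Proof. by move=> [x0 s0]; rewrite vvecE mulr_gt0 ?sqrtr_gt0. Qed.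

Lemma wvecE z i : positive_pair z ->
  wvec z i 0 = vvec z i 0 * (delta z - 1 - ln (uvec z i 0)).
Proof.
move=> iz; rewrite /wvec !col_entryE !Diag_mulE !col_entryE Diag_mulE vvec_sqr//.
by rewrite -uvecE; ring.
Qed.

Lemma corrector_rhsE z i : positive_pair z ->
  corrector_rhs z i 0 = (mu z - z.1 i 0 * z.2 i 0) / vvec z i 0.
Proof.
move=> iz; have v0 i' := gt_eqF (vvec_gt0 z i' iz).
rewrite /corrector_rhs (@invmx_Diag _ (map_mx (fun a : R => a^-1) (vvec z))).
  rewrite !col_entryE Diag_mulE col_entryE [allones _ _ _ _]mxE mulr1.
  rewrite -vvec_sqr//; field.
  exact: negbT (v0 i).
by move=> j; rewrite col_entryE divff// v0.
Qed.

Definition scaling z : 'cV[R]_n :=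
  \col_i (Num.sqrt (z.1 i 0) / Num.sqrt (z.2 i 0)).

Definition scaling_inv z : 'cV[R]_n :=
  \col_i (Num.sqrt (z.2 i 0) / Num.sqrt (z.1 i 0)).

Lemma scalingV z i : positive_pair z -> scaling z i 0 * scaling_inv z i 0 = 1.
Proof.
move=> [x0 s0]; rewrite !mxE; field.
by rewrite !gt_eqF ?sqrtr_gt0.
Qed.

Lemma Dmat_Diag z : positive_pair z -> Dmat z = Diag (scaling z).
Proof.
move=> [x0 s0]; rewrite /Dmat /sqrtDiag.
rewrite (@invmx_Diag _ (\col_i (Num.sqrt (z.2 i 0))^-1)).
  by rewrite /Diag mulmx_diag; congr diag_mx; apply/matrixP => i j; rewrite !mxE.
by move=> i; rewrite !mxE divff// gt_eqF ?sqrtr_gt0.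
Qed.

Lemma invmx_Dmat z : positive_pair z -> invmx (Dmat z) = Diag (scaling_inv z).
Proof.
move=> iz; rewrite Dmat_Diag//; apply: invmx_Diag => i; exact: scalingV.
Qed.

Lemma Dmat_unitmx z : positive_pair z -> Dmat z \in unitmx.
Proof.
move=> iz; rewrite Dmat_Diag//.
by have [] := mulmx1_unit (Diag_mulV _ _ (fun i => scalingV z i iz)).
Qed.

Lemma move1E z dx ds a i : positive_pair z ->
  (move z dx ds a).1 i 0 = z.1 i 0 + a * (scaling z i 0 * dx i 0).
Proof. by move=> iz; rewrite 2!mxE Dmat_Diag// Diag_mulE. Qed.

Lemma move2E z dx ds a i : positive_pair z ->
  (move z dx ds a).2 i 0 = z.2 i 0 + a * (scaling_inv z i 0 * ds i 0).
Proof. by move=> iz; rewrite 2!mxE invmx_Dmat// Diag_mulE. Qed.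

(** With [p = sqrt x] and [q = sqrt s], the linear coefficient [x (q / p) ds + s (p / q) dx] is
    [p q (dx + ds)]; in the quadratic one the two scalings cancel. *)
Lemma move_prodE z dx ds a i : positive_pair z ->
  (move z dx ds a).1 i 0 * (move z dx ds a).2 i 0 =
  z.1 i 0 * z.2 i 0 + a * (vvec z i 0 * (dx i 0 + ds i 0))
  + a ^+ 2 * (dx i 0 * ds i 0).
Proof.
move=> iz; have [x0 s0] := iz; rewrite move1E// move2E// vvecE !mxE.
have key (x s p q d e : R) : p ^+ 2 = x -> q ^+ 2 = s -> p != 0 -> q != 0 ->
    (x + a * (p / q * d)) * (s + a * (q / p * e)) =
    x * s + a * (p * q * (d + e)) + a ^+ 2 * (d * e).
  by move=> <- <- p0 q0; field; rewrite p0.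
by apply: key; rewrite ?sqr_sqrtr ?gt_eqF ?sqrtr_gt0 ?ltW.
Qed.

(** [dx] lies in the null space of [A D], and [ds] in its row space. *)
Lemma scaled_directions_orth z r dx ds :
  scaled_directions A z r dx ds -> \sum_i dx i 0 * ds i 0 = 0.
Proof.
move=> [dy [e1 e2 _]]; transitivity ((dx^T *m ds) 0 0).
  by rewrite mxE; apply: eq_bigr => i _; rewrite mxE.
have -> : ds = - ((A *m Dmat z)^T *m dy) by apply/eqP; rewrite -addr_eq0 addrC e1.
by rewrite mulmxN mulmxA -trmx_mul e2 trmx0 mul0mx oppr0 mxE.
Qed.

Lemma scaled_directions_sum z r dx ds i :
  scaled_directions A z r dx ds -> dx i 0 + ds i 0 = r i 0.
Proof. by move=> [dy [_ _ <-]]; rewrite mxE. Qed.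

Lemma scaled_directions_ex z r : \rank A = m -> positive_pair z ->
  exists dx ds, scaled_directions A z r dx ds.
Proof.
move=> rA iz; apply: projection_ex.
by rewrite /row_free mxrankMfree ?rA// row_free_unit Dmat_unitmx.
Qed.

Lemma strictly_feasible_interior z : strictly_feasible A b c z -> positive_pair z.
Proof. by case. Qed.

(** The primal equations persist because [A D dx = 0]. Since [D] is symmetric, [D^-1 ds = - A^T dy],
    so the dual witness moves by [a *: dy]. *)
Lemma move_feasible z r dx ds a :
  strictly_feasible A b c z -> scaled_directions A z r dx ds ->
  positive_pair (move z dx ds a) -> strictly_feasible A b c (move z dx ds a).
Proof.
move=> fz [dy [e1 e2 _]] [x0 s0]; have iz := strictly_feasible_interior z fz.
have [Ax [y Ay] _ _] := fz; split=> //.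
  by rewrite mulmxDr -scalemxAr mulmxA e2 scaler0 addr0.
exists (y + a *: dy); rewrite /= -{}Ay mulmxDr -scalemxAr addrACA -scalerDr.
have -> : ds = - ((A *m Dmat z)^T *m dy) by apply/eqP; rewrite -addr_eq0 addrC e1.
have DT : (Dmat z)^T = Dmat z by rewrite Dmat_Diag// /Diag tr_diag_mx.
rewrite trmx_mul DT mulmxN -(mulmxA (Dmat z)) mulKmx ?Dmat_unitmx//.
by rewrite addrN scaler0 addr0.
Qed.

Lemma gap_move z r dx ds a :
  positive_pair z -> scaled_directions A z r dx ds ->
  gap (move z dx ds a) = gap z + a * \sum_i vvec z i 0 * r i 0.
Proof.
move=> iz sd; rewrite !gapE; under eq_bigr => i _ do rewrite move_prodE//.
rewrite !big_split /= -!mulr_sumr (scaled_directions_orth z r dx ds)// mulr0 addr0.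
congr (_ + _ * _); apply: eq_bigr => i _.
by rewrite (scaled_directions_sum z r).
Qed.

Lemma move_prod_sumsq_le z r dx ds : scaled_directions A z r dx ds ->
  \sum_i (dx i 0 * ds i 0) ^+ 2 <= (2^-1 * \sum_i r i 0 ^+ 2) ^+ 2.
Proof.
move=> sd; under [X in _ <= (_ * X) ^+ 2]eq_bigr => i _ do
  rewrite -(scaled_directions_sum z r dx ds)//.
exact: sumsq_prod_le (fun i => dx i 0) (fun i => ds i 0)
  (scaled_directions_orth z r dx ds sd).
Qed.

(** Positivity of the product at [a] alone would allow both factors to be negative; positivity on
    all of [[0, a]] excludes a sign change. *)
Lemma move_positive_pair z dx ds a : positive_pair z -> 0 <= a ->
  (forall t i, 0 <= t <= a ->
     0 < (move z dx ds t).1 i 0 * (move z dx ds t).2 i 0) ->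
  positive_pair (move z dx ds a).
Proof.
move=> iz a0 H; have [x0 s0] := iz; split=> i.
  rewrite move1E//; apply: (@linear_pos _ _ _ (z.2 i 0)
    (scaling_inv z i 0 * ds i 0)) => // t ta.
  by rewrite -(move1E z dx ds)// -(move2E z dx ds)// H.
rewrite move2E//; apply: (@linear_pos _ _ _ (z.1 i 0)
    (scaling z i 0 * dx i 0)) => // t ta.
by rewrite mulrC -(move1E z dx ds)// -(move2E z dx ds)// H.
Qed.

(** This is [mu^2 |u - e|^2], the centrality residual cleared of root and division. Along a
    predictor step it is a polynomial in the step length. *)
Definition deviation z := \sum_i (z.1 i 0 * z.2 i 0 - mu z) ^+ 2.

Lemma norm2_uvecE z beta : (0 < n)%N -> positive_pair z -> 0 <= beta ->
  (norm2 (uvec z - allones R n) <= beta) = (deviation z <= (beta * mu z) ^+ 2).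
Proof.
move=> n0 iz b0; have mu0 := mu_gt0 z n0 iz.
have -> : deviation z =
    mu z ^+ 2 * \sum_i (uvec z - allones R n) i 0 ^+ 2.
  rewrite mulr_sumr; apply: eq_bigr => i _.
  by rewrite !col_entryE Diag_mulE mxE; field; rewrite gt_eqF.
rewrite /norm2 -{1}(ger0_norm b0) -sqrtr_sqr ler_sqrt ?sqr_ge0//.
have -> : (beta * mu z) ^+ 2 = mu z ^+ 2 * beta ^+ 2 by ring.
by rewrite ler_pM2l ?exprn_gt0.
Qed.

Lemma N2P z beta : (0 < n)%N -> 0 <= beta ->
  N2 A b c beta z <->
  strictly_feasible A b c z /\ deviation z <= (beta * mu z) ^+ 2.
Proof.
move=> n0 b0; split=> -[fz H]; split=> //;
  by move: H; rewrite norm2_uvecE//; apply: strictly_feasible_interior.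
Qed.

Lemma N2_positive_pair z beta : N2 A b c beta z -> positive_pair z.
Proof. by case=> /strictly_feasible_interior. Qed.

Lemma deviation_coord z beta i : 0 <= beta -> 0 <= mu z ->
  deviation z <= (beta * mu z) ^+ 2 ->
  (1 - beta) * mu z <= z.1 i 0 * z.2 i 0 <= (1 + beta) * mu z.
Proof.
move=> b0 m0 H.
have : (z.1 i 0 * z.2 i 0 - mu z) ^+ 2 <= (beta * mu z) ^+ 2.
  apply: le_trans H.
  apply: (sum_term_le (fun i => (z.1 i 0 * z.2 i 0 - mu z) ^+ 2)) => j.
  exact: sqr_ge0.
rewrite -ler_sqrt ?sqr_ge0// !sqrtr_sqr (ger0_norm (mulr_ge0 b0 m0)) ler_norml.
by move=> /andP[h1 h2]; apply/andP; split; lra.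
Qed.
End Steps.

(** * Analysis of one iteration, beginning with the corrector step *)

Section Algorithm.
Context {R : realType} {m n : nat}.
Context (A : 'M[R]_(m, n)) (b : 'cV[R]_m) (c : 'cV[R]_n).
Implicit Types (z : iterate R n) (dx ds : 'cV[R]_n).
Context (n_gt0 : (0 < n)%N).

Lemma corrector_N2 z dx ds :
  N2 A b c 2^-1 z -> scaled_directions A z (corrector_rhs z) dx ds ->
  N2 A b c (1 / 4) (move z dx ds 1) /\ gap (move z dx ds 1) = gap z.
Proof.
move=> Nz sd; have iz := N2_positive_pair _ _ _ _ _ Nz.
have mu0 := mu_gt0 z n_gt0 iz.
have half0 : 0 <= 2^-1 :> R by lra.
have tm : 0 < 2 / mu z by apply: divr_gt0.
have mt : 0 < mu z / 2 by apply: divr_gt0.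
have /(N2P _ _ _ _ _ n_gt0 half0)[fz dev] := Nz.
have xs i := deviation_coord z _ i half0 (ltW mu0) dev.
have vr i : vvec z i 0 * (dx i 0 + ds i 0) = mu z - z.1 i 0 * z.2 i 0.
  rewrite (scaled_directions_sum _ _ _ _ _ _ sd) corrector_rhsE// mulrC divfK//.
  by rewrite gt_eqF ?vvec_gt0.
(* The sum of [v r] is that of [mu - x s], which is [n mu - gap = 0]. *)
have gapm : gap (move z dx ds 1) = gap z.
  rewrite (gap_move _ _ _ _ _ _ iz sd) mul1r; apply/eqP.
  rewrite -subr_eq0 addrC addKr; apply/eqP.
  under eq_bigr => i _ do rewrite -(scaled_directions_sum _ _ _ _ _ i sd) vr.
  by rewrite sumrB -gapE sumr_const card_ord -mulr_natl -gap_mu// subrr.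
(* Here [r^2 = (x s - mu)^2 / (x s)]. In N_2(1/2) one has [x s >= mu / 2] and deviation at most
   [mu^2 / 4], whence [mu / 2]. *)
have sumr : \sum_i corrector_rhs z i 0 ^+ 2 <= mu z / 2.
  apply: (@le_trans _ _ (2 / mu z * deviation z)); last first.
    apply: (@le_trans _ _ (2 / mu z * (2^-1 * mu z) ^+ 2)).
      by rewrite (ler_pM2l tm).
    by rewrite [leLHS](_ : _ = mu z / 2)//; field; rewrite gt_eqF.
  rewrite mulr_sumr; apply: ler_sum => i _.
  rewrite corrector_rhsE//; have -> : ((mu z - z.1 i 0 * z.2 i 0) / vvec z i 0) ^+ 2
      = (z.1 i 0 * z.2 i 0)^-1 * (z.1 i 0 * z.2 i 0 - mu z) ^+ 2.
    by rewrite -vvec_sqr//; field; rewrite gt_eqF ?vvec_gt0.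
  apply: ler_wpM2r; first exact: sqr_ge0.
  rewrite -[2 / _]invf_div lef_pV2 ?posrE//; first by have := xs i; lra.
  by rewrite -vvec_sqr// mulr_gt0 ?vvec_gt0.
have sump : \sum_i (dx i 0 * ds i 0) ^+ 2 <= (1 / 4 * mu z) ^+ 2.
  apply: le_trans (move_prod_sumsq_le _ _ _ _ _ sd) _.
  rewrite ler_sqr ?nnegrE; [lra| |lra].
  by rewrite mulr_ge0// sumr_ge0// => i _; apply: sqr_ge0.
have p_ge i : - (1 / 4 * mu z) <= dx i 0 * ds i 0.
  have : (dx i 0 * ds i 0) ^+ 2 <= (1 / 4 * mu z) ^+ 2.
    apply: le_trans sump; apply: (sum_term_le (fun i => (dx i 0 * ds i 0) ^+ 2)).
    by move=> j; apply: sqr_ge0.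
  by nra.
(* The product at [t] is [(1 - t) x s + t mu + t^2 dx ds], at least [mu (1/2 + t/2 - t^2/4) > 0] on
   [[0, 1]]. *)
have im : positive_pair (move z dx ds 1).
  apply: move_positive_pair => // t i t01; rewrite move_prodE// vr.
  have t2 : t ^+ 2 <= 1 by nra.
  have := xs i; have := p_ge i; nra.
have q0 : 0 <= 1 / 4 :> R by lra.
split=> //; apply/(N2P _ _ _ _ _ n_gt0 q0); split; first exact: move_feasible sd im.
(* At the full step the product is [mu + dx ds] with [mu] unchanged, so the residual is exactly
   [dx ds]. *)
rewrite /deviation /mu gapm -/(mu z); apply: le_trans sump.
apply: ler_sum => i _; rewrite move_prodE// vr.
by rewrite expr1n !mul1r addrAC subrKC subrr add0r.
Qed.

(** * The predictor step *)

Lemma sum_uvec z : positive_pair z -> \sum_i uvec z i 0 = n%:R.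
Proof.
move=> iz; have mu0 := mu_gt0 z n_gt0 iz.
under eq_bigr => i _ do rewrite uvecE.
by rewrite -mulr_sumr -gapE gap_mu// mulrC mulfK ?gt_eqF.
Qed.

Lemma sum_uvec_ln z : \sum_i uvec z i 0 * ln (uvec z i 0) = n%:R * delta z.
Proof. by rewrite /delta mulrA divff ?mul1r// pnatr_eq0 -lt0n. Qed.

Lemma uvec_coord z i : N2 A b c (1 / 4) z ->
  3 / 4 <= uvec z i 0 <= 5 / 4.
Proof.
move=> Nz; have iz := N2_positive_pair _ _ _ _ _ Nz; have mu0 := mu_gt0 z n_gt0 iz.
have q0 : 0 <= 1 / 4 :> R by lra.
have /(N2P _ _ _ _ _ n_gt0 q0)[_ dev] := Nz.
have := deviation_coord z _ i q0 (ltW mu0) dev.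
rewrite uvecE [_^-1 * _]mulrC (ler_pdivrMr _ _ mu0) (ler_pdivlMr _ _ mu0).
move=> /andP[h1 h2].
by apply/andP; split; lra.
Qed.

(** [delta] is the mean of [ln u] under the weights [u / n], so the sum is [n] times a variance, at
    most the second moment. Then [u ln^2 u <= (5/4)(16/9)(u - 1)^2], and the squares [(u - 1)^2] sum
    to at most 1/16. *)
Lemma entropy_variance_le z : N2 A b c (1 / 4) z ->
  \sum_i uvec z i 0 * (delta z - ln (uvec z i 0)) ^+ 2 <= 5 / 36.
Proof.
move=> Nz; have iz := N2_positive_pair _ _ _ _ _ Nz; have mu0 := mu_gt0 z n_gt0 iz.
have q0 : 0 <= 1 / 4 :> R by lra.
have /(N2P _ _ _ _ _ n_gt0 q0)[_ dev] := Nz.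
have -> : \sum_i uvec z i 0 * (delta z - ln (uvec z i 0)) ^+ 2 =
    \sum_i uvec z i 0 * ln (uvec z i 0) ^+ 2 - n%:R * delta z ^+ 2.
  transitivity (\sum_i (uvec z i 0 * ln (uvec z i 0) ^+ 2
     + delta z ^+ 2 * uvec z i 0
     - 2 * delta z * (uvec z i 0 * ln (uvec z i 0)))).
    by apply: eq_bigr => i _; ring.
  rewrite !big_split /= sumrN -!mulr_sumr sum_uvec// sum_uvec_ln; ring.
apply: (@le_trans _ _ (\sum_i (20 / 9 * (uvec z i 0 - 1) ^+ 2))).
  have d0 : 0 <= n%:R * delta z ^+ 2 by rewrite mulr_ge0 ?sqr_ge0.
  apply: (@le_trans _ _ (\sum_i uvec z i 0 * ln (uvec z i 0) ^+ 2)); first lra.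
  apply: ler_sum => i _; have /andP[u1 u2] := uvec_coord _ i Nz.
  have := ln_sqr_le _ u1; have := sqr_ge0 (ln (uvec z i 0)).
  have := sqr_ge0 (uvec z i 0 - 1); nra.
rewrite -mulr_sumr.
have : mu z ^+ 2 * \sum_i (uvec z i 0 - 1) ^+ 2 <= mu z ^+ 2 * (1 / 16).
  rewrite mulr_sumr; have -> : mu z ^+ 2 * (1 / 16) = (1 / 4 * mu z) ^+ 2 by field.
  apply: le_trans dev; apply: ler_sum => i _; rewrite uvecE -exprMn mulrBr.
  by rewrite mulVKf ?mulr1// gt_eqF.
by rewrite ler_pM2l ?exprn_gt0//; lra.
Qed.

(** Expand [w^2 = mu u (delta - ln u - 1)^2]: the cross term sums to 0 because [delta] is the
    weighted mean, leaving [mu] times [n] plus the variance, and [5/36 <= n]. *)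
Lemma wvec_sumsq_le z : N2 A b c (1 / 4) z ->
  \sum_i wvec z i 0 ^+ 2 <= 2 * (n%:R * mu z).
Proof.
move=> Nz; have iz := N2_positive_pair _ _ _ _ _ Nz; have mu0 := mu_gt0 z n_gt0 iz.
have -> : \sum_i wvec z i 0 ^+ 2 = mu z *
  (n%:R + \sum_i uvec z i 0 * (delta z - ln (uvec z i 0)) ^+ 2).
  transitivity (\sum_i mu z * (uvec z i 0 - 2 * (delta z * uvec z i 0)
     + 2 * (uvec z i 0 * ln (uvec z i 0))
     + uvec z i 0 * (delta z - ln (uvec z i 0)) ^+ 2)).
    apply: eq_bigr => i _; rewrite wvecE// exprMn [vvec _ _ _ ^+ 2]expr2 vvec_sqr//.
    have -> : z.1 i 0 * z.2 i 0 = mu z * uvec z i 0.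
      by rewrite uvecE mulVKf// gt_eqF.
    by ring.
  rewrite -mulr_sumr !big_split /= sumrN -!mulr_sumr sum_uvec// sum_uvec_ln; ring.
have n1 : 1 <= n%:R :> R by rewrite ler1n.
by have := entropy_variance_le _ Nz; nra.
Qed.

(** Again the entropy terms of [v w = mu u (delta - 1 - ln u)] cancel in the sum, which leaves
    [- n mu]. *)
Lemma predictor_gap z dx ds t : positive_pair z ->
  scaled_directions A z (wvec z) dx ds ->
  gap (move z dx ds t) = (1 - t) * gap z.
Proof.
move=> iz sd; have mu0 := mu_gt0 z n_gt0 iz.
rewrite (gap_move _ _ _ _ _ _ iz sd).
suff -> : \sum_i vvec z i 0 * wvec z i 0 = - gap z by ring.
transitivity (\sum_i mu z * (delta z * uvec z i 0 - uvec z i 0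
     - uvec z i 0 * ln (uvec z i 0))).
  apply: eq_bigr => i _; rewrite wvecE// mulrA vvec_sqr//.
  have -> : z.1 i 0 * z.2 i 0 = mu z * uvec z i 0.
    by rewrite uvecE mulVKf// gt_eqF.
  by ring.
rewrite -mulr_sumr !big_split /= !sumrN -!mulr_sumr sum_uvec// sum_uvec_ln.
by rewrite gap_mu//; ring.
Qed.

Lemma predictor_mu z dx ds t : positive_pair z ->
  scaled_directions A z (wvec z) dx ds ->
  mu (move z dx ds t) = (1 - t) * mu z.
Proof. by move=> iz sd; rewrite /mu predictor_gap// mulrA. Qed.

Definition short_step : R := 1 / (4 * Num.sqrt n%:R).

Lemma sqrtn_ge1 : 1 <= Num.sqrt n%:R :> R.
Proof. by rewrite -{1}[1]sqrtr1 ler_sqrt// ler1n. Qed.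

Lemma short_stepP : 0 < short_step <= 1 / 4.
Proof.
have s1 := sqrtn_ge1; rewrite /short_step; apply/andP; split.
  by rewrite divr_gt0//; lra.
by rewrite ler_pdivrMr; lra.
Qed.

Lemma predictor_deviation z dx ds t : N2 A b c (1 / 4) z ->
  scaled_directions A z (wvec z) dx ds -> 0 < t <= short_step ->
  deviation (move z dx ds t) <= (2^-1 * mu (move z dx ds t)) ^+ 2.
Proof.
move=> Nz sd /andP[t0 ts].
have iz := N2_positive_pair _ _ _ _ _ Nz; have mu0 := mu_gt0 z n_gt0 iz.
have q0 : 0 <= 1 / 4 :> R by lra.
have /(N2P _ _ _ _ _ n_gt0 q0)[_ dev] := Nz.
have /andP[_ s4] := short_stepP.
have n0 : 0 < n%:R :> R by rewrite ltr0n.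
have tn : t ^+ 2 * n%:R <= 1 / 16.
  have s1 := sqrtn_ge1.
  have : t * Num.sqrt n%:R <= 1 / 4.
    apply: le_trans (ler_wpM2r _ ts) _; first lra.
    by rewrite [leLHS](_ : _ = 1 / 4)// /short_step; field; rewrite gt_eqF//; lra.
  have -> : t ^+ 2 * n%:R = (t * Num.sqrt n%:R) ^+ 2.
    by rewrite exprMn sqr_sqrtr// ltW.
  have : 0 <= t * Num.sqrt n%:R by nra.
  by nra.
rewrite /deviation predictor_mu//.
(* The residual splits into the shrunken old residual [f], the first-order entropy term [g] and the
   second-order term [h]; [a], [d], [e] will bound their norms. *)
pose f i := (1 - t) * (z.1 i 0 * z.2 i 0 - mu z).
pose g i := t * mu z * (uvec z i 0 * (delta z - ln (uvec z i 0))).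
pose h i := t ^+ 2 * (dx i 0 * ds i 0).
rewrite (eq_bigr (fun i => (f i + g i + h i) ^+ 2)); last first.
  move=> i _; congr (_ ^+ 2); rewrite move_prodE//.
  rewrite (scaled_directions_sum _ _ _ _ _ _ sd) wvecE//.
  rewrite [vvec _ _ _ * _]mulrA vvec_sqr// /f /g /h.
  have -> : z.1 i 0 * z.2 i 0 = mu z * uvec z i 0.
    by rewrite uvecE mulVKf// gt_eqF.
  by ring.
have mut : 0 < mu z * t by rewrite mulr_gt0.
pose a := (1 - t) * (1 / 4 * mu z); pose d := t * mu z * (5 / 12).
pose e := t ^+ 2 * (n%:R * mu z).
have t1 : 0 < 1 - t by lra.
have a0 : 0 < a by rewrite /a mulr_gt0//; lra.
have d0 : 0 < d by rewrite /d [t * _]mulrC; apply: mulr_gt0 => //; lra.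
have e0 : 0 < e.
  by apply: mulr_gt0; [exact: exprn_gt0 | exact: mulr_gt0].
have fa : \sum_i f i ^+ 2 <= a ^+ 2.
  under eq_bigr => i _ do rewrite exprMn.
  by rewrite -mulr_sumr exprMn ler_wpM2l ?sqr_ge0.
(* One factor [u <= 5/4] is split off from [u^2]; then [(5/4)(5/36) = (5/12)^2]. *)
have gd : \sum_i g i ^+ 2 <= d ^+ 2.
  under eq_bigr => i _ do rewrite exprMn.
  rewrite -mulr_sumr (exprMn _ (t * mu z) (5 / 12)) ler_wpM2l ?sqr_ge0//.
  apply: (@le_trans _ _ (5 / 4 * (5 / 36))); last lra.
  apply: le_trans (ler_wpM2l _ (entropy_variance_le _ Nz)); last lra.
  rewrite mulr_sumr; apply: ler_sum => i _; rewrite exprMn expr2 -[leLHS]mulrA.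
  have /andP[u1 u2] := uvec_coord _ i Nz.
  by rewrite ler_wpM2r// mulr_ge0 ?sqr_ge0//; lra.
have he : \sum_i h i ^+ 2 <= e ^+ 2.
  under eq_bigr => i _ do rewrite exprMn.
  rewrite -mulr_sumr (exprMn _ (t ^+ 2)) ler_wpM2l ?sqr_ge0//.
  apply: le_trans (move_prod_sumsq_le _ _ _ _ _ sd) _.
  rewrite ler_sqr ?nnegrE.
  - by have := wvec_sumsq_le _ Nz; lra.
  - by rewrite mulr_ge0// sumr_ge0// => i _; apply: sqr_ge0.
  - by rewrite mulr_ge0 ?ltW.
have fgh := sumsq_add_le _ _ _ _ (addr_gt0 a0 d0) e0
  (sumsq_add_le _ _ _ _ a0 d0 fa gd) he.
apply: le_trans fgh _; rewrite ler_sqr ?nnegrE.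
(* After division by [mu], what must hold is [(1 - t)/4 + 5t/12 + 1/16 <= (1 - t)/2], that is
   [2t/3 <= 3/16], true for [t <= 1/4]. *)
- rewrite /a /d /e; have := ler_wpM2r (ltW mu0) tn.
  by have := ler_wpM2r (ltW mu0) (le_trans ts s4); lra.
- by rewrite !addr_ge0 ?ltW.
- by apply: mulr_ge0 => //; apply: mulr_ge0; exact: ltW.
Qed.

(** The deviation bound holds at every positive step up to [short_step], so the products stay
    positive on the way and both factors do too. *)
Lemma short_step_admissible z dx ds : N2 A b c (1 / 4) z ->
  scaled_directions A z (wvec z) dx ds ->
  admissible_steps A b c z dx ds short_step.
Proof.
move=> Nz sd; have iz := N2_positive_pair _ _ _ _ _ Nz.
have mu0 := mu_gt0 z n_gt0 iz.
have /andP[s0 s4] := short_stepP.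
have half0 : 0 <= 2^-1 :> R by lra.
have im : positive_pair (move z dx ds short_step).
  apply: move_positive_pair (ltW s0) _ => // t i /andP[t0 ts].
  have [->|tn0] := eqVneq t 0.
    have [x0 y0] := iz; rewrite move1E// move2E// !mul0r !addr0; exact: mulr_gt0.
  have tt : 0 < t <= short_step by rewrite ts lt_def tn0 t0.
  have mut : 0 < mu (move z dx ds t) by rewrite predictor_mu// mulr_gt0//; lra.
  have := deviation_coord _ _ i half0 (ltW mut)
    (predictor_deviation _ _ _ _ Nz sd tt).
  by lra.
apply/(N2P _ _ _ _ _ n_gt0 half0); split; last first.
  by apply: predictor_deviation => //; rewrite s0 lexx.
by apply: move_feasible sd im; case: Nz.
Qed.

(** * The supremum of the admissible steps *)

Lemma admissible_lt1 z dx ds t : positive_pair z ->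
  scaled_directions A z (wvec z) dx ds ->
  admissible_steps A b c z dx ds t -> t < 1.
Proof.
move=> iz sd /N2_positive_pair im; have g0 := gap_gt0 _ n_gt0 iz.
have := gap_gt0 _ n_gt0 im; rewrite (predictor_gap _ _ _ _ iz sd).
by rewrite pmulr_lgt0// subr_gt0.
Qed.

(* For [t <= 1] admissibility amounts to polynomial inequalities in [t], so it
   survives the passage to the supremum as long as the gap does not vanish. *)
Lemma sup_admissible z dx ds : N2 A b c (1 / 4) z ->
  scaled_directions A z (wvec z) dx ds ->
  sup (admissible_steps A b c z dx ds) < 1 ->
  admissible_steps A b c z dx ds (sup (admissible_steps A b c z dx ds)).
Proof.
move=> Nz sd; set S := admissible_steps A b c z dx ds; set t := sup S => t1.
have iz := N2_positive_pair _ _ _ _ _ Nz; have mu0 := mu_gt0 z n_gt0 iz.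
have half0 : 0 <= 2^-1 :> R by lra.
have S0 : (S !=set0)%classic by exists short_step; apply: short_step_admissible.
have Sub : has_ubound S.
  by exists 1 => a /(admissible_lt1 _ _ _ _ iz sd)/ltW.
have lim := sup_horner_ge0 _ _ S0 Sub.
pose px i : {poly R} := (z.1 i 0)%:P + 'X * (scaling z i 0 * dx i 0)%:P.
pose ps i : {poly R} := (z.2 i 0)%:P + 'X * (scaling_inv z i 0 * ds i 0)%:P.
have pxE i a : (px i).[a] = (move z dx ds a).1 i 0.
  by rewrite move1E// !hornerE.
have psE i a : (ps i).[a] = (move z dx ds a).2 i 0.
  by rewrite move2E// !hornerE.
pose pm : {poly R} := (1 - 'X) * (mu z)%:P.
have pmE a : pm.[a] = mu (move z dx ds a).
  by rewrite predictor_mu// !hornerE.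
(* Nonnegativity of [q] encodes the deviation bound. *)
pose q : {poly R} := (2^-1%:P * pm) ^+ 2 - \sum_i (px i * ps i - pm) ^+ 2.
have qE a : q.[a] = (2^-1 * mu (move z dx ds a)) ^+ 2 - deviation (move z dx ds a).
  rewrite hornerD hornerN horner_exp hornerM hornerC pmE horner_sum.
  congr (_ - _); apply: eq_bigr => i _.
  by rewrite horner_exp hornerD hornerN hornerM pxE psE pmE.
have dev : deviation (move z dx ds t) <= (2^-1 * mu (move z dx ds t)) ^+ 2.
  rewrite -subr_ge0 -qE; apply: lim => a /(N2P _ _ _ _ _ n_gt0 half0)[_].
  by rewrite qE subr_ge0.
have mut : 0 < mu (move z dx ds t) by rewrite predictor_mu// mulr_gt0// subr_gt0.
have prod0 i : 0 < (move z dx ds t).1 i 0 * (move z dx ds t).2 i 0.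
  by have := deviation_coord _ _ i half0 (ltW mut) dev; lra.
(* The limit yields only weak signs; the positive products from [prod0] make them strict. *)
have x0 i : 0 <= (move z dx ds t).1 i 0.
  rewrite -pxE; apply: lim => a /N2_positive_pair[x0 _]; rewrite pxE; exact: ltW.
have s0 i : 0 <= (move z dx ds t).2 i 0.
  rewrite -psE; apply: lim => a /N2_positive_pair[_ s0]; rewrite psE; exact: ltW.
have im : positive_pair (move z dx ds t).
  split=> i; rewrite lt_def ?x0 ?s0 andbT; apply/negP => /eqP e0;
    by have := prod0 i; rewrite e0 ?mul0r ?mulr0 ltxx.
apply/(N2P _ _ _ _ _ n_gt0 half0); split=> //.
by apply: move_feasible sd im; case: Nz.
Qed.

(** * Progress of an iteration and termination of the loop *)

Lemma iteration_ex z : \rank A = m -> N2 A b c (1 / 4) z ->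
  exists z', iteration A b c z z'.
Proof.
move=> rA Nz; have iz := N2_positive_pair _ _ _ _ _ Nz.
have [dx [ds sd]] := scaled_directions_ex _ _ (wvec z) rA iz.
have [[a amax]|nomax] :=
  pselect (exists a, is_maximum (admissible_steps A b c z dx ds) a).
  have /N2_positive_pair im := amax.1.
  have [dx' [ds' sd']] := scaled_directions_ex _ _
    (corrector_rhs (move z dx ds a)) rA im.
  by exists (move (move z dx ds a) dx' ds' 1); exact: PredictorCorrector sd amax sd'.
by eexists; exact: PredictorLimit sd nomax.
Qed.

(** A maximal step is at least [short_step], and the corrector keeps the gap. Without a maximum the
    supremum cannot be below 1, since it would be admissible; so it is 1 and the gap vanishes. *)
Lemma iteration_gap z z' : N2 A b c (1 / 4) z -> iteration A b c z z' ->
  gap z' = 0 \/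
  N2 A b c (1 / 4) z' /\ gap z' <= (1 - short_step) * gap z.
Proof.
move=> Nz it; have iz := N2_positive_pair _ _ _ _ _ Nz.
have g0 := gap_gt0 _ n_gt0 iz.
case: it => [dx ds dx' ds' a sd [Sa amax] /= sd'|dx ds sd nomax].
  right; have [Nm ->] := corrector_N2 _ _ _ Sa sd'; split=> //.
  rewrite (predictor_gap _ _ _ _ iz sd) ler_pM2r// lerD2l lerN2.
  exact/amax/short_step_admissible.
left; rewrite (predictor_gap _ _ _ _ iz sd).
set S := admissible_steps _ _ _ _ _ _.
have S0 : (S !=set0)%classic by exists short_step; apply: short_step_admissible.
have S1 : ubound S 1 by move=> a /(admissible_lt1 _ _ _ _ iz sd)/ltW.
have := ge_sup S0 S1; rewrite le_eqVlt => /orP[/eqP->|lt1].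
  by rewrite subrr mul0r.
case: nomax; exists (sup S); split; first exact: sup_admissible.
by apply: ub_le_sup; exists 1.
Qed.

Lemma halts_withinP eps k z : \rank A = m -> N2 A b c (1 / 4) z -> 0 < eps ->
  (1 - short_step) ^+ k * gap z <= eps -> halts_within A b c eps k z.
Proof.
move=> rA Nz eps0; elim: k z Nz => [|k IH] z Nz; first by rewrite mul1r; left.
move=> gz; right; split; first exact: iteration_ex.
move=> z' /(iteration_gap _ _ Nz)[gz'|[Nz' gz']].
  (* A zero gap meets the stopping test for any number of remaining passes. *)
  by case: k {IH gz} => [|k]; left; rewrite gz' ltW.
apply: IH => //; apply: le_trans gz; rewrite exprSr -mulrA ler_wpM2l//.
by rewrite exprn_ge0//; have /andP[] := short_stepP; lra.
Qed.
End Algorithm.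

(** * From geometric decrease to the iteration bound *)

Lemma geometric_le {R : realType} (t M eps : R) (k : nat) :
  t <= 1 -> 0 < eps -> 0 < M -> ln (M / eps) <= t * k%:R ->
  (1 - t) ^+ k * M <= eps.
Proof.
move=> t1 e0 M0 lnk; rewrite -ler_pdivlMr//.
apply: (@le_trans _ _ (expR (- t) ^+ k)).
  by rewrite lerXn2r ?nnegrE ?expR_ge0 ?subr_ge0// expR_ge1Dx.
rewrite -expRM_natl; apply: (@le_trans _ _ (expR (- ln (M / eps)))).
  by rewrite ler_expR mulrN lerN2 [leRHS]mulrC.
by rewrite expRN lnK ?posrE ?divr_gt0// invf_div.
Qed.

(* C is absolute; the threshold eps0 depends only on a bound G on the initial
   duality gap. *)
Theorem theorem3p1 (R : realType) :
  exists C : R, 0 < C /\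
  forall G : R, exists eps0 : R, 0 < eps0 /\
  forall (m n : nat) (A : 'M[R]_(m, n)) (b : 'cV[R]_m) (c : 'cV[R]_n)
    (z0 : iterate R n) (eps : R),
    (0 < n)%N -> \rank A = m -> N2 A b c (1 / 4) z0 -> gap z0 <= G ->
    0 < eps ->
    exists K : nat,
      halts_within A b c eps K z0 /\
      (eps <= eps0 -> K%:R <= C * (Num.sqrt n%:R * ln (1 / eps))).
Proof.
(* With [L = ln (1 / eps)] and [ln M <= L], the bound [T] is at most [8 sqrt n L]; the rounding unit
   costs one more [sqrt n L], as [sqrt n >= 1] and [L >= 1]. *)
exists 9; split; first lra.
(* The maximum with 1 ensures [M > 0] and [ln M >= 0] for every [G]. *)
move=> G; pose M := Num.max G 1.
have M1 : 1 <= M by rewrite le_max lexx orbT.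
have M0 : 0 < M by lra.
(* Below this threshold [ln M + 1 <= ln (1 / eps)], which absorbs the initial gap. *)
exists (expR (- 1) / M); split; first by rewrite divr_gt0 ?expR_gt0.
move=> m n A b c z0 eps n0 rA Nz gG e0.
have gM : gap z0 <= M by rewrite le_max gG.
have /andP[t0 t4] := @short_stepP R n n0.
have s1 := @sqrtn_ge1 R n n0.
pose T := 4 * Num.sqrt n%:R * ln (M / eps).
(* Truncation rounds down, so the successor is what dominates [T]. *)
exists (Num.truncn T).+1; split.
  apply: (halts_withinP _ _ _ n0 _ _ _ rA Nz e0).
  apply: (@le_trans _ _ ((1 - @short_step R n) ^+ (Num.truncn T).+1 * M)).
    by rewrite ler_wpM2l// exprn_ge0//; lra.
  apply: geometric_le => //; first lra.
  have := ltW (truncnS_gt T); rewrite -(ler_pM2l t0); apply: le_trans.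
  rewrite [leRHS](_ : _ = ln (M / eps))// /T /short_step; field.
  by rewrite gt_eqF//; lra.
move=> eps_le; have lnE : ln (M / eps) = ln M + ln (1 / eps).
  by rewrite div1r lnM ?posrE ?invr_gt0.
have i0 : 0 < 1 / eps by rewrite divr_gt0.
have lnM0 : 0 <= ln M by rewrite ln_ge0.
have lnM1 : ln M + 1 <= ln (1 / eps).
  rewrite -[X in _ + X]expRK -lnM ?posrE ?expR_gt0// ler_ln ?posrE//.
    rewrite div1r -[leLHS]invrK lef_pV2 ?posrE ?invr_gt0 ?mulr_gt0 ?expR_gt0//.
    by rewrite invfM mulrC -expRN.
  by rewrite mulr_gt0 ?expR_gt0.
have T0 : 0 <= T by rewrite /T !mulr_ge0 ?lnE//; lra.
have /andP[trT _] := truncn_itv T0.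
rewrite -natr1; apply: (@le_trans _ _ (T + 1)); first by rewrite lerD2r.
rewrite /T lnE; nra.
Qed.
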